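(* Let $X$ be a finite subset of a metric space $Z$ and let $k \geq 0$ be an integer such that $L_{s,k}(X) \neq \emptyset$ for $s$ sufficiently large. Then the poset inclusion $\alpha: \operatorname{Br}_{k}(X) \to \Gamma_{k}(X)$ has an inverse up to homotopy, given by the poset map $$max: \Gamma_{k}(X) \to \operatorname{Br}_{k}(X),$$ and $\operatorname{Br}_{k}(X)$ is a strong deformation retract of $\Gamma_{k}(X)$.
   Context: Let $d$ be the metric on $Z$. All distance parameters $s,t,\dots$ are real numbers $\geq 0$. $V_{s}(X)$ is the simplicial complex whose simplices are the non-empty subsets $\sigma \subset X$ with $d(x,y) \leq s$ for all $x,y \in \sigma$. $L_{s,k}(X)$ is the subcomplex of $V_{s}(X)$ whose simplices are those $\sigma$ such that each vertex $x \in \sigma$ satisfies $d(x,y) \leq s$ for at least $k$ distinct points $y \neq x$ in $X$. For $s \leq t$ there is an inclusion $L_{s,k}(X) \subset L_{t,k}(X)$. $\Gamma_{k}(X)$ is the poset whose elements (vertices) are the pairs $(s,[x])$ with $s \geq 0$ and $[x] \in \pi_{0}L_{s,k}(X)$ (the path component of a vertex $x$ of $L_{s,k}(X)$), with $(s,[x]) \leq (t,[y])$ if and only if $s \leq t$ and $[x]=[y]$ in $\pi_{0}L_{t,k}(X)$. A vertex $(t,[x])$ of $\Gamma_{k}(X)$ is a branch point if either (1) there is an $s_{0}<t$ such that for all $s_{0} \leq s < t$ there are distinct vertices $(s,[x_{0}])$ and $(s,[x_{1}])$ with $(s,[x_{0}]) \leq (t,[x])$ and $(s,[x_{1}]) \leq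 (t,[x])$; or (2) there is no relation $(s,[y]) \leq (t,[x])$ with $s<t$. $\operatorname{Br}_{k}(X)$ is the set of branch points with the partial order inherited from $\Gamma_{k}(X)$, and $\alpha$ is the inclusion. Every vertex $(s,[x])$ of $\Gamma_{k}(X)$ has a unique largest branch point $(s_{0},[x_{0}])$ with $(s_{0},[x_{0}]) \leq (s,[x])$, called the maximal branch point below $(s,[x])$. The function $max$ is defined by $max(s,[x]) = (s_{0},[x_{0}])$. A homotopy between poset maps $f,g: P \to Q$ is a pointwise relation between them: $f(p) \leq g(p)$ for all $p \in P$, or $g(p) \leq f(p)$ for all $p \in P$ (such a relation induces a homotopy of maps of nerves). A subposet $\alpha: P \subset Q$ is a strong deformation retract of $Q$ if there is a poset map $\rho: Q \to P$ such that $\rho \cdot \alpha = 1_{P}$ and there is a homotopy between $\alpha \cdot \rho$ and $1_{Q}$ which restricts to the identity on $P$. *)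

(* Defs.v *)
From HB Require Import structures.
From mathcomp Require Import all_boot all_order all_algebra finmap.
From mathcomp Require Import all_classical all_reals all_analysis.

Set Implicit Arguments.
Unset Strict Implicit.
Unset Printing Implicit Defensive.

Import Order.TTheory GRing.Theory Num.Theory.

Local Open Scope classical_set_scope.
Local Open Scope ring_scope.

(* An abstract simplicial complex on the points of a choiceType is given by its
   set of simplices, each of which is a finite set of points. *)
Section PathComponents.
Context {Z : choiceType}.
Implicit Types (K : set {fset Z}) (x y : Z).

Definition vertices K : set Z := [set x | K [fset x]%fset].

(* The case u = v of [fset u; v] is a constant step at a vertex. *)
Definition edge_connected K x y : Prop :=
  exists2 p : seq Z, path (fun u v => `[< K [fset u; v]%fset >]) x p & y = last x p.

Definition component K x : set Z := [set y | edge_connected K x y].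

(* Path components are represented by their sets of vertices; for a complex
   they are the same whether computed from edge paths or in the geometric
   realization. *)
Definition pi0 K : set (set Z) := [set component K x | x in vertices K].

Lemma edge_connected_refl K x : edge_connected K x x.
Proof. by exists [::]. Qed.

Lemma edge_connected_trans K x y z :
  edge_connected K x y -> edge_connected K y z -> edge_connected K x z.
Proof.
move=> [p pp ->] [q qq ->]; exists (p ++ q); last by rewrite last_cat.
by rewrite cat_path pp.
Qed.

Lemma edge_connected_sym K x y : edge_connected K x y -> edge_connected K y x.
Proof.
move=> [p pp ->]; exists (rev (belast x p)); last first.
  by case: p {pp} => //= a p; rewrite rev_cons last_rcons.
rewrite rev_path; apply: sub_path pp => u v.
by rewrite fsetUC.
Qed.

Lemma edge_connected_sub K K' x y :
  K `<=` K' -> edge_connected K x y -> edge_connected K' x y.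
Proof.
move=> KK' [p pp ->]; exists p => //; apply: sub_path pp => u v /asboolP uv.
by apply/asboolP; exact: KK'.
Qed.

Lemma component_eq K x y :
  edge_connected K x y -> component K x = component K y.
Proof.
move=> xy; apply/seteqP; split=> z; apply: edge_connected_trans => //.
exact: edge_connected_sym.
Qed.

Lemma component_eqP K x y :
  component K x = component K y <-> edge_connected K x y.
Proof.
split=> [E|]; last exact: component_eq.
by have : component K y y := edge_connected_refl K y; rewrite -E.
Qed.

End PathComponents.

Section Complexes.
Context {R : realType} {Z : metricType R}.
Implicit Types (X : {fset Z}) (x y : Z) (s t : R) (k : nat).

Definition Vietoris_Rips X s : set {fset Z} :=
  [set sigma | [/\ sigma != fset0%fset, (sigma `<=` X)%fset &
    forall x y, x \in sigma -> y \in sigma -> mdist x y <= s]].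

Definition neighbours X s x : {fset Z} :=
  [fset y in X | (y != x) && (mdist x y <= s)]%fset.

(* The complex L_{s,k}(X), also called the degree Rips complex. *)
Definition Lesnick X k s : set {fset Z} :=
  [set sigma | Vietoris_Rips X s sigma /\
    forall x, x \in sigma -> (k <= #|` neighbours X s x|)%N].

Lemma Lesnick_sub X k s t : s <= t -> Lesnick X k s `<=` Lesnick X k t.
Proof.
move=> st sigma [[s0 sX sd] sk]; split.
  by split=> // x y xs ys; exact: le_trans (sd _ _ xs ys) st.
move=> x /sk/leq_trans; apply; apply: fsubset_leq_card; apply/fsubsetP => y.
rewrite !inE /= => /and3P[-> -> /=] yx; exact: le_trans yx st.
Qed.

End Complexes.

(* The pairs (s, [x]); [level] is s and [comp] is the class [x]. *)
Record Gamma (R : realType) (Z : metricType R) (X : {fset Z}) (k : nat) :=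
  MkGamma {
  level : R;
  comp : set Z;
  level_ge0 : 0 <= level;
  comp_pi0 : pi0 (Lesnick X k level) comp }.

Section GammaPoset.
Context {R : realType} {Z : metricType R} {X : {fset Z}} {k : nat}.
Local Notation Gamma := (Gamma X k).
Implicit Types p q r : Gamma.

HB.instance Definition _ := gen_eqMixin Gamma.
HB.instance Definition _ := gen_choiceMixin Gamma.

(* [comp q] is the image of [comp p] under the map of path components induced
   by the inclusion of complexes: it is the class of a representative of
   [comp p]; see [Gamma_leE]. *)
Definition Gamma_le p q : bool :=
  `[< level p <= level q /\
      exists2 x, comp p x & comp q = component (Lesnick X k (level q)) x >].

Lemma Gamma_eq p q : level p = level q -> comp p = comp q -> p = q.
Proof.
case: p q => s C s0 CC [t D t0 DD] /= st CD; subst t; subst D.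
by congr MkGamma; exact: Prop_irrelevance.
Qed.

Lemma comp_component p x :
  comp p x -> comp p = component (Lesnick X k (level p)) x.
Proof. by case: (comp_pi0 p) => y _ <- /component_eq. Qed.

Fact Gamma_le_refl : reflexive Gamma_le.
Proof.
move=> p; apply/asboolP; split=> //; case: (comp_pi0 p) => x _ E.
by exists x => //; rewrite -E; exact: edge_connected_refl.
Qed.

Fact Gamma_le_anti : antisymmetric Gamma_le.
Proof.
move=> p q /andP[/asboolP[pq [x px qE]] /asboolP[qp _]].
have E : level p = level q by apply/eqP; rewrite eq_le pq qp.
by apply: Gamma_eq => //; rewrite qE -E; exact: comp_component.
Qed.

Fact Gamma_le_trans : transitive Gamma_le.
Proof.
move=> q p r /asboolP[pq [x px qE]] /asboolP[qr [y qy rE]]; apply/asboolP.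
split; first exact: le_trans qr.
exists x => //; rewrite rE; apply/esym/component_eq.
by apply: edge_connected_sub (Lesnick_sub qr) _; rewrite qE in qy.
Qed.

Fact Gamma_display : Order.disp_t. Proof. exact: Order.Disp tt tt. Qed.

HB.instance Definition _ := Order.Le_isPOrder.Build Gamma_display Gamma
  Gamma_le_refl Gamma_le_anti Gamma_le_trans.

Lemma Gamma_leE p q x y : comp p = component (Lesnick X k (level p)) x ->
  comp q = component (Lesnick X k (level q)) y ->
  (p <= q)%O <-> level p <= level q /\
    component (Lesnick X k (level q)) x = component (Lesnick X k (level q)) y.
Proof.
move=> pE qE; split=> [/asboolP[pq [z pz qz]]|[pq E]]; last first.
  apply/asboolP; split=> //; exists x; last by rewrite E.
  by rewrite pE; exact: edge_connected_refl.
split=> //; rewrite -qE qz; apply/component_eq.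
by apply: edge_connected_sub (Lesnick_sub pq) _; rewrite pE in pz.
Qed.

Definition branch_point p : Prop :=
  (exists s0, [/\ 0 <= s0, s0 < level p &
     forall s, s0 <= s < level p -> exists q0 q1,
       [/\ level q0 = s, level q1 = s, q0 <> q1, (q0 <= p)%O & (q1 <= p)%O]])
  \/ ~ (exists2 q, (q <= p)%O & level q < level p).

End GammaPoset.

Record Br (R : realType) (Z : metricType R) (X : {fset Z}) (k : nat) := MkBr {
  Br_val :> Gamma X k;
  _ : `[< branch_point Br_val >] }.

Section BrPoset.
Context {R : realType} {Z : metricType R} {X : {fset Z}} {k : nat}.

HB.instance Definition _ := [isSub for @Br_val R Z X k].
HB.instance Definition _ := [Choice of Br X k by <:].
HB.instance Definition _ :=
  [SubChoice_isSubPOrder of Br X k by <: with Gamma_display].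

Definition maximal_branch_point_below (p : Gamma X k) (b : Br X k) : Prop :=
  (val b <= p)%O /\ forall c : Br X k, (val c <= p)%O -> (c <= b)%O.

End BrPoset.

Section Homotopy.
Context {d d' : Order.disp_t}.

Definition homotopic {P : porderType d} {Q : porderType d'}
    (f g : {omorphism P -> Q}) : Prop :=
  (forall p, (f p <= g p)%O) \/ (forall p, (g p <= f p)%O).

(* A pointwise relation between f and g restricts to the identity on S when
   the relation f p <= g p, or g p <= f p, is an equality for p in S. *)
Definition homotopic_rel {P : porderType d} {Q : porderType d'} (S : set P)
    (f g : {omorphism P -> Q}) : Prop :=
  homotopic f g /\ forall p, S p -> f p = g p.

End Homotopy.

Definition homotopy_inverse {d d'} {P : porderType d} {Q : porderType d'}
    (f : {omorphism P -> Q}) (g : {omorphism Q -> P}) : Prop :=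
  homotopic (g \o f) idfun /\ homotopic (f \o g) idfun.

Definition strong_deformation_retract {d d'} {Q : porderType d} {S : pred Q}
    (P : subPOrder S d') : Prop :=
  exists rho : {omorphism Q -> P},
    (forall p : P, rho (val p) = p) /\
    homotopic_rel (range (val : P -> Q)) (val \o rho) idfun.

Definition alpha {R : realType} {Z : metricType R} (X : {fset Z}) (k : nat) :
  {omorphism Br X k -> Gamma X k} := val.

(* Main.v *)
Require Import Defs.
From HB Require Import structures.
From mathcomp Require Import all_boot all_order all_algebra finmap.
From mathcomp Require Import all_classical all_reals all_analysis.

Set Implicit Arguments.
Unset Strict Implicit.
Unset Printing Implicit Defensive.

Import Order.TTheory GRing.Theory Num.Theory.

Local Open Scope classical_set_scope.
Local Open Scope ring_scope.

(** The complex [Lesnick X k s] changes only when [s] crosses one of the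
    finitely many critical values, namely 0 and the distances between points
    of [X].  If [c] is the largest critical value below [level p], then no
    vertex with level strictly between [c] and [level p] is a branch point: on
    every level from [c] up to its own, exactly one vertex lies below it, given
    by the same component ([not_branch_point_between]).

    If [p] is not a branch point, then there is a level [s], with
    [c <= s < level p], on which exactly one vertex lies below [p].  Moved down
    to level [c], where the complex is the same, it becomes a vertex [q <= p],
    and every branch point below [p] is already below [q]
    ([branch_points_below_descend]).  Induction on the number of critical values
    below [level p] then yields the maximal branch point below [p].

    The rest is formal: a greatest element of [Br X k] below each [p] gives a
    right adjoint to the inclusion, so it is monotone, restricts to the identity
    on [Br X k], and lies pointwise below the identity of [Gamma X k]. *)

Section Critical.
Context {R : realType} {Z : metricType R}.
Implicit Types (X : {fset Z}) (k : nat).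

(** The values at which [Lesnick X k] may change, together with the lowest
    level 0. *)
Definition critical_values X : {fset R} :=
  (0 |` [fset mdist x y | x in X, y in X])%fset.

Lemma largest_critical_below X (t : R) : 0 < t ->
  exists c, [/\ c \in critical_values X, 0 <= c, c < t &
    forall d, d \in critical_values X -> d < t -> d <= c].
Proof.
move=> t0.
suff H : forall S : seq R, exists c, [/\ c \in 0 :: S, 0 <= c, c < t &
    forall d, d \in 0 :: S -> d < t -> d <= c].
  have z0 : 0 \in critical_values X by rewrite !inE eqxx.
  have [c [cS c0 ct cm]] := H (critical_values X).
  exists c; split=> //; first by move: cS; rewrite inE => /predU1P[->|].
  by move=> d dX; apply: cm; rewrite inE; apply/orP; right.
elim=> [|a S [c [cS c0 ct cm]]].
  by exists 0; split=> // [|d]; rewrite inE // => /eqP ->.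
have [/andP[at_ ca]|aN] := boolP ((a < t) && (c < a)).
  exists a; split; rewrite ?inE ?eqxx ?orbT //; first exact: le_trans (ltW ca).
  move=> d; rewrite !inE => /or3P[/eqP ->|/eqP -> //|dS] dt.
    by rewrite (le_trans c0) // ltW.
  by apply: le_trans (ltW ca); apply: cm; rewrite // inE dS orbT.
exists c; split=> //.
  by move: cS; rewrite !inE => /orP[->|->]; rewrite ?orbT.
move=> d; rewrite !inE => /or3P[/eqP -> //|/eqP ->|dS] dt.
  by move: aN; rewrite dt /= -leNgt.
by apply: cm; rewrite // inE dS orbT.
Qed.

Lemma card_critical_below_lt X (c t : R) : c \in critical_values X -> c < t ->
  (#|` [fset d in critical_values X | (d < c)%R]%fset|
    < #|` [fset d in critical_values X | (d < t)%R]%fset|)%N.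
Proof.
move=> cX ct; apply: fproper_ltn_card; rewrite fproperE; apply/andP; split.
  by apply/fsubsetP => d; rewrite !inE => /andP[-> dc]; exact: lt_trans dc ct.
(* [c] itself lies in the right-hand set only. *)
apply/fsubsetPn; exists c; rewrite !inE /= ?ltxx ?andbF // ct andbT.
by move: cX; rewrite !inE.
Qed.

Lemma Lesnick_eq X k (s t : R) : s <= t ->
  (forall d, d \in critical_values X -> d <= t -> d <= s) ->
  Lesnick X k s = Lesnick X k t.
Proof.
move=> st H; apply/seteqP; split; first exact: Lesnick_sub.
have HX x y : x \in X -> y \in X -> mdist x y <= t -> mdist x y <= s.
  move=> xX yX; apply: H; rewrite in_fset1U; apply/orP; right.
  by apply/imfset2P; exists x => //; exists y.
move=> sigma [[s0 /[dup] sX /fsubsetP sXi sd] sk]; split.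
  by split=> // x y xs ys; apply: HX (sd _ _ xs ys); apply: sXi.
move=> x xs; apply: leq_trans (sk x xs) _; apply: fsubset_leq_card.
apply/fsubsetP => y; rewrite !inE /= => /and3P[yX -> yt].
by rewrite yX /= HX // sXi.
Qed.

End Critical.

Section Branch.
Context {R : realType} {Z : metricType R} {X : {fset Z}} {k : nat}.
Local Notation Gamma := (Gamma X k).
Local Notation L := (Lesnick X k).
Implicit Types (p q r : Gamma) (s c : R).

Lemma Gamma_le_level p q : (p <= q)%O -> level p <= level q.
Proof. by move=> /asboolP[]. Qed.

Lemma Gamma_le_comp p q : (p <= q)%O -> L (level p) = L (level q) ->
  Defs.comp p = Defs.comp q.
Proof. by move=> /asboolP[_ [x px ->]] <-; exact: comp_component. Qed.

Lemma Gamma_le_level_eq p q : (p <= q)%O -> level p = level q -> p = q.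
Proof.
by move=> pq E; apply: Gamma_eq => //; apply: Gamma_le_comp pq _; rewrite E.
Qed.

(** The image of a vertex on a higher level is the least vertex of that level
    or above which lies over it. *)
Lemma Gamma_push p s : level p <= s -> exists r,
  [/\ level r = s, (p <= r)%O &
    forall q, (p <= q)%O -> s <= level q -> (r <= q)%O].
Proof.
move=> ps; have s0 : 0 <= s by apply: le_trans ps; exact: level_ge0.
have [x xv xE] := comp_pi0 p.
have rc : pi0 (L s) (component (L s) x).
  by exists x => //; exact: Lesnick_sub ps _ xv.
exists (MkGamma s0 rc); split=> //.
  by apply/(Gamma_leE (esym xE) (erefl : Defs.comp (MkGamma s0 rc) = _)).
move=> q pq sq; case: (comp_pi0 q) => y yv yE.
apply/(Gamma_leE (erefl : Defs.comp (MkGamma s0 rc) = _) (esym yE)); split=> //.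
by case/(Gamma_leE (esym xE) (esym yE)): pq.
Qed.

Lemma Gamma_pull p c : 0 <= c -> c <= level p -> L c = L (level p) ->
  exists r, [/\ level r = c, Defs.comp r = Defs.comp p & (r <= p)%O].
Proof.
move=> c0 cp E; have rc : pi0 (L c) (Defs.comp p) by rewrite E; exact: comp_pi0.
exists (MkGamma c0 rc); split=> //.
have [x _ xE] := comp_pi0 p.
have rE : Defs.comp (MkGamma c0 rc) = component (L c) x by rewrite /= E xE.
by apply/(Gamma_leE rE (esym xE)).
Qed.

Lemma branch_point_level0 p : level p <= 0 -> branch_point p.
Proof.
move=> p0; right=> -[q _ /lt_le_trans/(_ p0)].
by rewrite ltNge level_ge0.
Qed.

Lemma not_branch_point_between p c : 0 <= c -> c < level p ->
  L c = L (level p) -> ~ branch_point p.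
Proof.
move=> c0 cp E [[s0 [s00 s0p H]]|]; last first.
  by have [r [rc _ rp]] := Gamma_pull c0 (ltW cp) E; apply; exists r; rewrite ?rc.
set s := Num.max s0 c.
have sp : s < level p by rewrite gt_max s0p.
have Es : L s = L (level p).
  apply/seteqP; split; first exact/Lesnick_sub/ltW.
  by rewrite -E; apply: Lesnick_sub; rewrite le_max lexx orbT.
have [|q0 [q1 [l0 l1 + q0p q1p]]] := H s; first by rewrite le_max lexx.
apply; apply: Gamma_eq; first by rewrite l0.
by rewrite (Gamma_le_comp q0p) ?(Gamma_le_comp q1p) // ?l0 ?l1.
Qed.

(** The hypothesis on [c] says that it bounds the critical values below
    [level p]. *)
Lemma branch_points_below_descend p c : 0 <= c -> c < level p ->
  (forall d, d \in critical_values X -> d < level p -> d <= c) ->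
  ~ branch_point p ->
  exists q, [/\ level q = c, (q <= p)%O &
    forall b, branch_point b -> (b <= p)%O -> (b <= q)%O].
Proof.
move=> c0 cp cm nbr.
have Lc s : c <= s -> s < level p -> L c = L s.
  by move=> cs sp; apply: Lesnick_eq => // d dX ds; apply: cm (le_lt_trans ds sp).
have [q qp qlt] : exists2 q, (q <= p)%O & level q < level p.
  by apply: contrapT => nq; apply: nbr; right.
(* The failure of the first kind of branching, started at a level where [p]
   has predecessors and the complex is already [L c]. *)
set s0 := Num.max (level q) c.
have s0p : s0 < level p by rewrite gt_max qlt.
have [s /andP[s0s sp] uniq_s] : exists2 s, s0 <= s < level p &
    forall q0 q1, level q0 = s -> level q1 = s ->
      (q0 <= p)%O -> (q1 <= p)%O -> q0 = q1.
  apply: contrapT => ns; apply: nbr; left; exists s0; split=> //.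
    by rewrite le_max c0 orbT.
  move=> s sP; apply: contrapT => nq; apply: ns; exists s => // q0 q1 l0 l1 h0 h1.
  by apply: contrapT => ne; apply: nq; exists q0, q1.
have [qs cs] : level q <= s /\ c <= s.
  by split; apply: le_trans s0s; rewrite le_max lexx ?orbT.
have [q1 [l1 qq1 /(_ p qp)]] := Gamma_push qs; rewrite (ltW sp) => /(_ isT) q1p.
have [|||r [rc rE rq1]] := @Gamma_pull q1 c; rewrite ?l1 //; first exact: Lc.
exists r; split=> //; first exact: le_trans q1p.
move=> b bb bp.
have blt : level b < level p.
  rewrite lt_neqAle Gamma_le_level // andbT; apply/eqP => E.
  by apply: nbr; rewrite -(Gamma_le_level_eq bp E).
have bc : level b <= c.
  rewrite leNgt; apply/negP => cb.
  by apply: (not_branch_point_between c0 cb _ bb); exact: Lc (ltW cb) blt.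
have [b1 [lb1 bb1 /(_ p bp)]] := Gamma_push (le_trans bc cs).
rewrite (ltW sp) => /(_ isT) b1p.
move: bb1; rewrite (uniq_s b1 q1) // => /asboolP[_ [x bx q1E]].
apply/asboolP; rewrite rc; split=> //; exists x => //.
by rewrite rE q1E l1 -(Lc s).
Qed.

Lemma maximal_branch_point_below_exists p :
  exists b : Br X k, maximal_branch_point_below p b.
Proof.
have [n] := ubnP #|` [fset d in critical_values X | (d < level p)%R]%fset|.
elim: n p => // n IHn p pn.
have [bp|nbp] := pselect (branch_point p).
  by exists (MkBr (asboolT bp)); split.
have p0 : 0 < level p.
  by rewrite ltNge; apply/negP => /branch_point_level0.
have [c [cX c0 cp cm]] := largest_critical_below X p0.
have [q [qc qp qb]] := branch_points_below_descend c0 cp cm nbp.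
have [|b [bq bm]] := IHn q.
  by rewrite qc; apply: leq_trans (card_critical_below_lt cX cp) _.
exists b; split=> [|a ap]; first exact: le_trans bq qp.
by apply/bm/qb => //; case: a {ap} => a ab; exact/asboolP.
Qed.

End Branch.

Theorem lemma7 (R : realType) (Z : metricType R) (X : {fset Z}) (k : nat)
    (hL : \forall s \near +oo, Lesnick X k s !=set0) :
  exists max : {omorphism Gamma X k -> Br X k},
    [/\ forall p : Gamma X k, maximal_branch_point_below p (max p),
        homotopy_inverse (alpha X k) max
      & strong_deformation_retract (Br X k)].
Proof.
have [f fP] := choice (@maximal_branch_point_below_exists R Z X k).
have f_mono : {homo f : p q / (p <= q)%O}.
  move=> p q pq; have [_] := fP q; apply.
  by have [fp _] := fP p; exact: le_trans fp pq.
have fK b : f (val b) = b.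
  by apply/le_anti/andP; split; have [fb fm] := fP (val b); [|apply: fm].
pose fM := Order.isOrderMorphism.Build _ _ _ _ f f_mono.
pose max : {omorphism Gamma X k -> Br X k} := HB.pack f fM.
exists max; split=> //.
- split; first by left=> b; rewrite /= fK.
  by left=> p; have [] := fP p.
- exists max; split=> //; split; first by left=> p; have [] := fP p.
  by move=> _ [b _ <-]; rewrite /= fK.
Qed.
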